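(* Let $R_1=\{(0,0),(0,1),(0,2),(1,0),(2,0),(2,2),(2,3),(3,2),(3,3)\}$ and $R_2=R_1\cup\{(1,1)\}$. Then $(123,R_1)\sim_d(132,R_1)$ and $(123,R_2)\sim_d(132,R_2)$.
   Context: $S_n$ denotes the set of permutations of $[n]=\{1,\dots,n\}$, written $\pi=\pi_1\cdots\pi_n$. A mesh pattern of length $k$ is a pair $(\tau,R)$ with $\tau\in S_k$ and $R\subseteq\{0,1,\dots,k\}^2$ (the shaded boxes; box $(a,b)$ is the unit square $[a,a+1]\times[b,b+1]$ in the diagram of $\tau$). An occurrence of $(\tau,R)$ in $\pi\in S_n$ is a choice of indices $i_1<\dots<i_k$ such that $\pi_{i_1}\cdots\pi_{i_k}$ is order-isomorphic to $\tau$ and, with $i_0=0$, $i_{k+1}=n+1$, $v_1<\dots<v_k$ the values $\pi_{i_1},\dots,\pi_{i_k}$ sorted increasingly, $v_0=0$, $v_{k+1}=n+1$, for every $(a,b)\in R$ there is no index $m$ with $i_a<m<i_{a+1}$ and $v_b<\pi_m<v_{b+1}$. Mesh patterns $p,q$ are equidistributed, $p\sim_d q$, if for all $n,\ell\ge0$ the number of $\pi\in S_n$ with exactly $\ell$ occurrences of $p$ equals the number with exactly $\ell$ occurrences of $q$. *)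

(* Defs.v *)
From mathcomp Require Import all_boot all_fingroup.

Set Implicit Arguments.
Unset Strict Implicit.
Unset Printing Implicit Defensive.

(* Permutations of [n] are elements of 'S_n acting on {0, ..., n-1}: the index
   (or value) written j+1 in one-line notation is the ordinal j. *)

Record mesh_pattern (k : nat) := MeshPattern {
  underlying : 'S_k;
  shading : {set 'I_k.+1 * 'I_k.+1}
}.

(* [fences s] is 0, s_0 + 1, ..., s_(k-1) + 1, n + 1: for the increasing list of
   chosen positions it gives i_0, ..., i_(k+1), and for the sorted list of
   chosen values it gives v_0, ..., v_(k+1), both in the 1-based convention. *)
Definition fences (n : nat) (s : seq 'I_n) : seq nat :=
  0 :: rcons [seq (nat_of_ord i).+1 | i <- s] n.+1.

Definition position_fence (n : nat) (s : seq 'I_n) (a : nat) : nat :=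
  nth 0 (fences s) a.

Definition value_fence (n : nat) (pi : 'S_n) (s : seq 'I_n) (b : nat) : nat :=
  nth 0 (fences (sort (fun u v : 'I_n => u <= v) [seq pi i | i <- s])) b.

Definition in_box (n : nat) (pi : 'S_n) (s : seq 'I_n) (a b : nat) (m : 'I_n) :
    bool :=
  (position_fence s a < m.+1 < position_fence s a.+1) &&
  (value_fence pi s b < (pi m).+1 < value_fence pi s b.+1).

Definition order_isomorphic (k n : nat) (tau : 'S_k) (pi : 'S_n)
    (s : k.-tuple 'I_n) : bool :=
  [forall x : 'I_k, forall y : 'I_k,
    (pi (tnth s x) < pi (tnth s y)) == (tau x < tau y)].

Definition occurrence (k n : nat) (p : mesh_pattern k) (pi : 'S_n)
    (s : k.-tuple 'I_n) : bool :=
  [&& sorted (fun i j : 'I_n => i < j) s,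
      order_isomorphic (underlying p) pi s
    & [forall ab in shading p, ~~ [exists m, in_box pi s ab.1 ab.2 m]]].

Definition occurrences (k n : nat) (p : mesh_pattern k) (pi : 'S_n) : nat :=
  #|[set s : k.-tuple 'I_n | occurrence p pi s]|.

Definition equidistributed (k k' : nat) (p : mesh_pattern k)
    (q : mesh_pattern k') : Prop :=
  forall n l : nat,
    #|[set pi : 'S_n | occurrences p pi == l]| =
    #|[set pi : 'S_n | occurrences q pi == l]|.

Notation "p '~d' q" := (equidistributed p q) (at level 70, no associativity).

Definition boxes (k : nat) (r : seq (nat * nat)) : {set 'I_k.+1 * 'I_k.+1} :=
  [set ab | (nat_of_ord ab.1, nat_of_ord ab.2) \in r].

Definition R1 : {set 'I_4 * 'I_4} :=
  boxes 3 [:: (0, 0); (0, 1); (0, 2); (1, 0); (2, 0);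
              (2, 2); (2, 3); (3, 2); (3, 3)].

Definition R2 : {set 'I_4 * 'I_4} := R1 :|: boxes 3 [:: (1, 1)].

Definition perm123 : 'S_3 := 1%g.

(* Exchanges the 0-based 1 and 2, i.e. the entries 2 and 3 of 123. *)
Definition perm132 : 'S_3 :=
  tperm (@Ordinal 3 1 isT) (@Ordinal 3 2 isT).

(* Main.v *)
Require Import Defs.
From mathcomp Require Import all_boot all_fingroup zify.

(* In an occurrence of either pattern, let p be the middle position. It
   determines the other two: for 123 the third point is the only one to the
   upper right of p, for 132 there is nothing to the upper right of the meet of
   the last two points, and the first point is the least one of the rectangle
   spanned by the occurrence. So occurrences are counted by their middle
   positions.

   Exchanging the values of the last two points turns a 123-occurrence into a
   132-occurrence with the same middle position and conversely. The resulting
   involution Phi_p of S_n preserves, for q < p, whether q is the middle of a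
   132-occurrence, and for q > p, whether q is the middle of a 123-occurrence.
   Hence applying the Phi_p one position at a time replaces 123-middles by
   132-middles without changing the distribution of their total number. *)

Set Implicit Arguments.
Unset Strict Implicit.
Unset Printing Implicit Defensive.

(** * Counting with predicates replaced one index at a time *)

Lemma hybrid_equidistribution (T : finType) (n : nat) (A B : 'I_n -> pred T)
    (Phi : 'I_n -> T -> T) (l : nat) :
  (forall p, injective (Phi p)) ->
  (forall p t, A p (Phi p t) = B p t) ->
  (forall (p q : 'I_n) t, q < p -> B q (Phi p t) = B q t) ->
  (forall (p q : 'I_n) t, p < q -> A q (Phi p t) = A q t) ->
  #|[set t | #|[set p | A p t]| == l]| = #|[set t | #|[set p | B p t]| == l]|.
Proof.
move=> injPhi AB BB AA.
(* [H k] counts B-indices below k and A-indices from k on; Phi k turns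
   [H k.+1] into [H k]. *)
pose H k t := #|[set p : 'I_n | if p < k then B p t else A p t]|.
have step k : k <= n -> #|[set t | H k t == l]| = #|[set t | H 0 t == l]|.
  elim: k => // k IHk lt_kn; rewrite -IHk 1?ltnW //.
  pose p := Ordinal lt_kn.
  rewrite -[RHS](on_card_preimset (f := Phi p)); last first.
    exact/onW_bij/injF_bij/injPhi.
  apply: eq_card => t; rewrite !inE; congr (_ == l).
  (* Apart from [p], the indices below carry [B] and those above carry [A], just the tests that
     [Phi p] preserves. *)
  apply: eq_card => q; rewrite !inE ltnS leq_eqVlt.
  have [eq_qk | /= neq_qk] := eqVneq (val q) k.
    have -> : q = p by apply: ord_inj.
    by rewrite ltnn AB.
  by case: ltnP => [lt_qk | le_kq];
    rewrite (BB, AA) //= ltn_neqAle eq_sym neq_qk.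
have -> : #|[set t | #|[set p | A p t]| == l]| = #|[set t | H 0 t == l]|.
  by [].
rewrite -(step n) //; apply: eq_card => t; rewrite !inE; congr (_ == l).
by apply: eq_card => q; rewrite !inE ltn_ord.
Qed.

(** * Occurrences in coordinates, and the exchange of two values *)

Section Exchange.

Variables (c : bool) (n : nat).
Implicit Types (f g : 'I_n -> nat) (x y z p q r m : 'I_n).

(* Occurrences of 123 (rising) and 132 (falling) at positions x < y < z. The
   third clause covers the boxes (2,2), (2,3), (3,2), (3,3); the fourth covers
   the shaded boxes of column 0 and row 0, and says that x is the least point of
   the rectangle below and left of the whole occurrence; the last is
   box (1,1). *)
Definition rising f x y z : Prop :=
  [/\ x < y < z,
      f x < f y < f z,
      forall m, y < m -> f y < f m -> m = z,
      forall m, m <= z -> f m <= f z -> x <= m /\ f x <= f m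
    & c -> forall m, x < m -> m < y -> f x < f m -> f y <= f m].

Definition falling f x y z : Prop :=
  [/\ x < y < z,
      f x < f z < f y,
      forall m, y < m -> f m <= f z,
      forall m, m <= z -> f m <= f y -> x <= m /\ f x <= f m
    & c -> forall m, x < m -> m < y -> f x < f m -> f z <= f m].

Definition exchanged f g p r : Prop :=
  [/\ g p = f r, g r = f p & forall m, m != p -> m != r -> g m = f m].

Lemma exchangedC f g p r : exchanged f g p r -> exchanged g f p r.
Proof. by case=> gp gr gm; split=> // m mp mr; rewrite gm. Qed.

(** Each third point is to the upper right of [y], so the third clause identifies them. Then each
    first point lies in the rectangle of the other, hence weakly right of it. *)
Lemma rising_uniq f x y z x' z' :
  rising f x y z -> rising f x' y z' -> x = x' /\ z = z'.
Proof.
move=> [xyz fxyz ne sw _] [xyz' fxyz' ne' sw' _].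
have zz' : z = z' by apply: ne'; lia.
subst z'; split=> //; apply: val_inj => /=.
by have := sw x'; have := sw' x; lia.
Qed.

(** [z] and [z'] both carry the largest value to the right of [y], so injectivity identifies
    them. *)
Lemma falling_uniq f x y z x' z' : injective f ->
  falling f x y z -> falling f x' y z' -> x = x' /\ z = z'.
Proof.
move=> injf [xyz fxyz ne sw _] [xyz' fxyz' ne' sw' _].
have zz' : z = z' by apply: injf; have := ne z'; have := ne' z; lia.
subst z'; split=> //; apply: val_inj => /=.
by have := sw x'; have := sw' x; lia.
Qed.

Lemma rising_not_falling f x y z x' z' :
  rising f x y z -> falling f x' y z' -> False.
Proof. by case=> xyz fxyz _ _ _ [xyz' fxyz' ne' _ _]; have := ne' z; lia. Qed.

(** The rectangle and its three values stay the same; the bound for box (1, 1) is the middle value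
    before and after. To the right of [p] only [r] exceeds [f p], so [g r = f p] bounds everything
    there afterwards. *)
Lemma exchange_rising f g x p r :
  exchanged f g p r -> rising f x p r -> falling g x p r.
Proof.
move=> [gp gr gm] [xpr fxpr ne sw box].
have gx : g x = f x by apply: gm; rewrite -val_eqE /=; lia.
split; rewrite ?gx ?gp ?gr //.
- move=> m lt_pm; have [-> | mr] := eqVneq m r; first by rewrite gr.
  rewrite (gm m) //; last by rewrite -val_eqE /=; lia.
  by rewrite leqNgt; apply/negP => /ne - /(_ lt_pm) /eqP; apply/negP.
- move=> m; have [-> | mr] := eqVneq m r; first by rewrite gr; lia.
  have [-> | mp] := eqVneq m p; first by rewrite gp; lia.
  by rewrite (gm m) //; apply: sw.
- move=> hc m xm mp; rewrite gm; first exact: box.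
    by rewrite -val_eqE /=; lia.
  by rewrite -val_eqE /=; lia.
Qed.

Lemma exchange_falling f g x p r :
  exchanged f g p r -> falling f x p r -> rising g x p r.
Proof.
move=> [gp gr gm] [xpr fxpr ne sw box].
have gx : g x = f x by apply: gm; rewrite -val_eqE /=; lia.
split; rewrite ?gx ?gp ?gr //.
- move=> m lt_pm; have [// | mr] := eqVneq m r.
  rewrite (gm m) //; last by rewrite -val_eqE /=; lia.
  by have := ne m lt_pm; lia.
- move=> m; have [-> | mr] := eqVneq m r; first by rewrite gr; lia.
  have [-> | mp] := eqVneq m p; first by rewrite gp; lia.
  by rewrite (gm m) //; apply: sw.
- move=> hc m xm mp; rewrite gm; first exact: box.
    by rewrite -val_eqE /=; lia.
  by rewrite -val_eqE /=; lia.
Qed.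

(** The third point of a falling occurrence with middle [q] carries the largest value right of [q].
    It is [r] for [f] exactly when it is [p] for [g]; otherwise it does not move. Swapping [f] and
    [g] serves a falling occurrence at [p]. *)
Lemma exchange_falling_before f g x p r q : injective f -> injective g ->
  exchanged f g p r -> rising f x p r -> q < p ->
  (exists x' z', falling f x' q z') <-> (exists x' z', falling g x' q z').
Proof.
move=> injf injg [gp gr gm] [xpr fxpr ne sw _] lt_qp.
have gq : g q = f q by apply: gm; rewrite -val_eqE /=; lia.
have glt m : m < p -> g m = f m.
  by move=> mp; apply: gm; rewrite -val_eqE /=; lia.
have gx : g x = f x by apply: glt; lia.
split=> -[x' [z' [xqz fxqz ne' sw' box]]].
- have [zr | zr] := eqVneq z' r.
    subst z'; exists x', p; split.
    + lia.
    + by rewrite gp gq glt //; lia.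
    + move=> m qm; rewrite gp; have [-> | mp] := eqVneq m p.
        by rewrite gp.
      have [-> | mr] := eqVneq m r; first by rewrite gr; lia.
      by rewrite (gm m) //; apply: ne'.
    + move=> m mp; rewrite gq (glt x'); last by lia.
      have [-> | np] := eqVneq m p; first by rewrite gp; lia.
      rewrite glt; last by move: np; rewrite -val_eqE /=; lia.
      by move=> ?; apply: sw' => //; lia.
    + move=> hc m xm mq; rewrite gp !glt; try lia.
      exact: box.
  have zp : z' != p.
    by apply/eqP => zp; subst z'; have := ne' r; lia.
  have fr : f r < f z'.
    rewrite ltn_neqAle ne' ?andbT; last by lia.
    by apply: contraNneq zr => /injf ->.
  have gz : g z' = f z' by apply: gm.
  exists x', z'; split; rewrite ?gz ?gq ?(glt x') //; try lia.
  + move=> m qm; have [-> | mp] := eqVneq m p; first by rewrite gp; lia.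
    have [-> | mr] := eqVneq m r; first by rewrite gr; lia.
    by rewrite (gm m) //; apply: ne'.
  + move=> m mz; have [mp | mp] := eqVneq m p.
      by subst m; rewrite gp; have := sw' p; lia.
    have [mr | mr] := eqVneq m r.
      by subst m; rewrite gr; have := sw' p; lia.
    by rewrite (gm m) //; apply: sw'.
  + by move=> hc m xm mq; rewrite glt; [apply: box | lia].
- rewrite gq (glt x') in fxqz sw' box; last by lia.
  have fx' : g x' = f x' by apply: glt; lia.
  have [zp | zp] := eqVneq z' p.
    subst z'; rewrite ?gp in fxqz ne' sw' box.
    exists x', r; split.
    + lia.
    + lia.
    + move=> m qm; have [-> // | mr] := eqVneq m r.
      have [-> | mp] := eqVneq m p; first by lia.
      by rewrite -(gm m) //; apply: ne'.
    (* The rectangle now reaches right to [r] instead of [p]. As the first points agree, minimality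
       at [p] covers the positions gained. *)
    + have xx' : x = x' by apply: ord_inj; have := sw x'; have := sw' x; lia.
      subst x'; move=> m mr mq; have := sw m mr; have := sw' m.
      have [mx | ] := ltnP m x; last by lia.
      by rewrite (glt m); lia.
    + move=> hc m xm mq; rewrite -(glt m); last by lia.
      exact: box.
  have zr : z' != r.
    by apply/eqP => zr; subst z'; have := ne' p; lia.
  have fz : g z' = f z' by apply: gm.
  have fr : f r < f z'.
    rewrite ltn_neqAle -gp -fz ne' ?andbT; last by lia.
    by apply: contraNneq zp => /injg ->.
  rewrite fz in fxqz ne' box.
  exists x', z'; split; rewrite ?fz //; try lia.
  + move=> m qm; have [-> | mp] := eqVneq m p; first by lia.
    have [-> | mr] := eqVneq m r; first by lia.
    by rewrite -(gm m) //; apply: ne'.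
  + move=> m mz; have [mp | mp] := eqVneq m p.
      (* At [p] itself the clause would concern [g p = f r]; applied to [x], it gives a bound below
         [f p]. *)
      by subst m; have := sw' x; lia.
    have [mr | mr] := eqVneq m r.
      by subst m; have := sw' p; lia.
    by rewrite -(gm m) //; apply: sw'.
  + by move=> hc m xm mq; rewrite -(glt m); [apply: box | lia].
Qed.

(** To the right of [p] only [r] rises above [f p], so [r] is the middle of no rising occurrence and
    both exchanged values exceed [f q]. If [q < r], the third point is [r] before and after; if
    [r < q], it does not move. *)
Lemma exchange_rising_after f g x p r q : injective f ->
  exchanged f g p r -> rising f x p r -> p < q ->
  (exists x' z', rising f x' q z') <-> (exists x' z', rising g x' q z').
Proof.
move=> injf [gp gr gm] [xpr fxpr ne sw _] lt_pq.
have pq : q != p by rewrite -val_eqE /=; lia.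
have below m : p < m -> m != r -> f m < f p.
  move=> pm mr; rewrite ltnNge leq_eqVlt; apply/norP; split.
    by apply/eqP => /injf mp; subst m; lia.
  by apply/negP => /ne -/(_ pm) /eqP; apply/negP.
have gx : g x = f x by apply: gm; rewrite -val_eqE /=; lia.
split=> -[x' [z' [xqz fxqz ne' sw' box]]].
- have qr : q != r.
    apply/eqP => qr; subst q.
    by have zr : z' = r; [apply: ne; lia | subst z'; lia].
  have fq := below q lt_pq qr.
  have gq : g q = f q by apply: gm.
  have gx' : g x' = f x'.
    apply: gm; first by apply/eqP => xp; subst x'; lia.
    by apply/eqP => xr; subst x'; lia.
  have box' : c -> forall m, x' < m -> m < q -> f x' < g m -> f q <= g m.
    move=> hc m xm mq; have [-> | mp] := eqVneq m p; first by lia.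
    have [-> | mr] := eqVneq m r; first by lia.
    by rewrite (gm m) //; apply: box.
  have [lt_qr | le_rq] := ltnP q r.
    have zr : r = z' by apply: ne'; lia.
    subst z'; exists x', r; split; rewrite ?gr ?gq ?gx' //; try lia.
    + move=> m qm; have [// | mr] := eqVneq m r.
      by rewrite (gm m) //; [apply: ne' | rewrite -val_eqE /=; lia].
    + move=> m mr; have [-> | mp] := eqVneq m p; first by lia.
      have [-> | mr'] := eqVneq m r; first by lia.
      by rewrite gm // => ?; apply: sw'; lia.
  have lt_rq : r < q.
    by rewrite ltn_neqAle le_rq andbT eq_sym.
  have gz : g z' = f z' by apply: gm; rewrite -val_eqE /=; lia.
  have fz : f z' < f p by apply: below; rewrite -?val_eqE /=; lia.
  exists x', z'; split; rewrite ?gz ?gq ?gx' //; try lia.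
  + move=> m qm; rewrite gm -?val_eqE /=; try lia.
    exact: ne'.
  + move=> m mz; have [-> | mp] := eqVneq m p; first by lia.
    have [-> | mr] := eqVneq m r; first by lia.
    by rewrite (gm m) //; apply: sw'.
- have qr : q != r.
    apply/eqP => qr; subst q.
    have gz : g z' = f z' by apply: gm; rewrite -val_eqE /=; lia.
    by have zr : z' = r; [apply: ne; lia | subst z'; lia].
  have fq := below q lt_pq qr.
  have gq : g q = f q by apply: gm.
  have fx' : g x' = f x'.
    apply: gm; first by apply/eqP => xp; subst x'; lia.
    by apply/eqP => xr; subst x'; lia.
  rewrite gq fx' in fxqz ne' sw' box.
  have box' : c -> forall m, x' < m -> m < q -> f x' < f m -> f q <= f m.
    move=> hc m xm mq; have [-> | mp] := eqVneq m p; first by lia.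
    have [-> | mr] := eqVneq m r; first by lia.
    by rewrite -(gm m) //; apply: box.
  have [lt_qr | le_rq] := ltnP q r.
    have zr : r = z' by apply: ne'; lia.
    subst z'; rewrite gr in fxqz sw'.
    exists x', r; split; try (done || lia).
    + move=> m qm; have [// | mr] := eqVneq m r.
      by rewrite -(gm m) //; [apply: ne' | rewrite -val_eqE /=; lia].
    (* For [f] the rectangle reaches up to [f r], beyond the [f p] that [sw'] covers; the first
       points agree, so [sw] applies. *)
    + have xx' : x = x' :> nat by have := sw x'; have := sw' x; lia.
      have fxx' : f x = f x' by have := sw x'; have := sw' x; lia.
      by rewrite -xx' -fxx'.
  have lt_rq : r < q.
    by rewrite ltn_neqAle le_rq andbT eq_sym.
  have gz : g z' = f z' by apply: gm; rewrite -val_eqE /=; lia.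
  have fz : f z' < f p by apply: below; rewrite -?val_eqE /=; lia.
  rewrite gz in fxqz sw'.
  exists x', z'; split; try (done || lia).
  + move=> m qm; rewrite -(gm m) -?val_eqE /=; try lia.
    exact: ne'.
  + move=> m mz; have [-> | mp] := eqVneq m p; first by lia.
    have [-> | mr] := eqVneq m r; first by lia.
    by rewrite -(gm m) //; apply: sw'.
Qed.

End Exchange.

(** * Mesh occurrences translated into coordinates *)

Lemma boxes_emptyP (k n : nat) (pi : 'S_n) (s : seq 'I_n)
    (r : seq (nat * nat)) :
  all (fun ab => (ab.1 <= k) && (ab.2 <= k)) r ->
  reflect (forall m, all (fun ab => ~~ in_box pi s ab.1 ab.2 m) r)
    [forall ab in boxes k r, ~~ [exists m, in_box pi s ab.1 ab.2 m]].
Proof.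
move=> /allP le_rk; apply: (iffP forall_inP) => [free m | free ab].
  apply/allP => -[a b] r_ab; have /andP[/= le_ak le_bk] := le_rk _ r_ab.
  have := free (inord a, inord b); rewrite inE /= !inordK // => /(_ r_ab).
  by rewrite negb_exists => /forallP.
rewrite inE => r_ab; rewrite negb_exists; apply/forallP => m.
by have /allP/(_ _ r_ab) := free m.
Qed.

(** [c] is read as a multiplicity; box (1, 1) comes last so that the nine common boxes keep fixed
    places. *)
Definition shaded_boxes (c : bool) : seq (nat * nat) :=
  [:: (0, 0); (0, 1); (0, 2); (1, 0); (2, 0); (2, 2); (2, 3); (3, 2); (3, 3)]
  ++ nseq c (1, 1).

(* [c] tells whether the box (1, 1) is shaded, i.e. selects R2 over R1. *)
Definition shade (c : bool) := if c then R2 else R1.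

Lemma shadeE c : shade c = boxes 3 (shaded_boxes c).
Proof. by case: c => //=; apply/setP => ab; rewrite !in_set mem_cat !inE. Qed.

Lemma perm132E (i : 'I_3) : perm132 i = nth 0 [:: 0; 2; 1] i :> nat.
Proof. by rewrite permE /=; case: i => [[|[|[|]]]]. Qed.


Lemma occurrence_rising c n (pi : 'S_n) (x y z : 'I_n) :
  occurrence (MeshPattern perm123 (shade c)) pi [tuple x; y; z] <->
  rising c (fun i => pi i) x y z.
Proof.
have emptyE : x < y < z -> pi x < pi y < pi z ->
    (forall m, all (fun ab => ~~ in_box pi [:: x; y; z] ab.1 ab.2 m)
      (shaded_boxes c)) <-> rising c (fun i => pi i) x y z.
  move=> xyz fxyz.
  have sortE : sort (fun u v : 'I_n => u <= v) [:: pi x; pi y; pi z] =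
      [:: pi x; pi y; pi z].
    apply: sorted_sort => [u v w|/=]; [exact: leq_trans | lia].
  rewrite /in_box /value_fence /= sortE /position_fence /=.
  split=> [free | [_ _ ne sw box] m].
  (* Injectivity puts a point outside the occurrence off all its grid lines, so weak and strict
     inequalities agree. *)
  - have neq (m u : 'I_n) : m != u -> m != u :> nat /\ pi m != pi u :> nat.
      by move=> mu; rewrite !val_eqE (inj_eq perm_inj).
    split=> // [m ym fym | m mz fmz | cT m xm my fxm].
    + apply/eqP; apply: contraT => /neq[mz fmz].
      (* These bounds keep [m] below the outer fences [n.+1]; the five boxes of column 0 and row 0
         are then skipped. *)
      have := ltn_ord m; have := ltn_ord (pi m).
      have := free m; rewrite !ltnS; do 5 case/andP=> _.
      by case/and5P=> h22 h23 h32 h33 _; lia.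
    + have [-> | /neq[mx fmx]] := eqVneq m x; first by lia.
      have [-> | /neq[my fmy]] := eqVneq m y; first by lia.
      have [-> | /neq[mz' fmz']] := eqVneq m z; first by lia.
      have := free m; rewrite !ltnS.
      case/and5P=> h00 h01 h02 h10 /andP[h20 _].
      by split; lia.
    + by have := free m; rewrite cT /= !ltnS; do 9 case/andP=> _; lia.
  - have {}ne : y < m -> pi y < pi m -> m = z :> nat /\ pi m = pi z :> nat.
      by move=> ym fym; rewrite (ne m).
    rewrite !ltnS; do 9 (apply/andP; split;
      first by (have := sw m; lia) || lia).
    by case: c box => //= /(_ isT m); lia.
have le3 : all (fun ab => (ab.1 <= 3) && (ab.2 <= 3)) (shaded_boxes c).
  by case: (c).
split.
  case/and3P => /= sorted_s /forallP iso; rewrite shadeE.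
  move=> /(boxes_emptyP _ _ le3) free.
  have lt (i j : 'I_3) := eqP (forallP (iso i) j).
  apply/emptyE; [lia | | exact: free].
  have := lt (@Ordinal 3 0 isT) (@Ordinal 3 1 isT).
  have := lt (@Ordinal 3 1 isT) (@Ordinal 3 2 isT).
  by rewrite !perm1 /tnth /= => -> ->.
move=> H; have [xyz fxyz _ _ _] := H.
apply/and3P; split => /=; first by lia.
  apply/forallP => i; apply/forallP => j; rewrite !perm1 !(tnth_nth x).
  by case: i j => [[|[|[|]]] //= ?] [[|[|[|]]] //= ?]; apply/eqP; lia.
by rewrite shadeE; apply/(boxes_emptyP _ _ le3)/emptyE.
Qed.

Lemma occurrence_falling c n (pi : 'S_n) (x y z : 'I_n) :
  occurrence (MeshPattern perm132 (shade c)) pi [tuple x; y; z] <->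
  falling c (fun i => pi i) x y z.
Proof.
have emptyE : x < y < z -> pi x < pi z < pi y ->
    (forall m, all (fun ab => ~~ in_box pi [:: x; y; z] ab.1 ab.2 m)
      (shaded_boxes c)) <-> falling c (fun i => pi i) x y z.
  move=> xyz fxyz.
  have sortE : sort (fun u v : 'I_n => u <= v) [:: pi x; pi y; pi z] =
      [:: pi x; pi z; pi y].
    have trans : transitive (fun u v : 'I_n => u <= v).
      by move=> u v w; apply: leq_trans.
    rewrite -(sorted_sort trans (s := [:: pi x; pi z; pi y])) /=; last by lia.
    apply/perm_sortP => //.
    - by move=> u v; apply: leq_total.
    - by move=> u v uv; apply: val_inj; apply: anti_leq.
    - by rewrite perm_cons (perm_catC [:: pi y] [:: pi z]).
  rewrite /in_box /value_fence /= sortE /position_fence /=.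
  split=> [free | [_ _ ne sw box] m].
  - have neq (m u : 'I_n) : m != u -> m != u :> nat /\ pi m != pi u :> nat.
      by move=> mu; rewrite !val_eqE (inj_eq perm_inj).
    split=> // [m ym | m mz fmz | cT m xm my fxm].
    + have [-> // | /neq[mz fmz]] := eqVneq m z.
      have [my | /neq[my fmy]] := eqVneq m y; first by subst m; lia.
      have := ltn_ord m; have := ltn_ord (pi m).
      have := free m; rewrite !ltnS; do 5 case/andP=> _.
      by case/and5P=> h22 h23 h32 h33 _; lia.
    + have [-> | /neq[mx fmx]] := eqVneq m x; first by lia.
      have [-> | /neq[my fmy]] := eqVneq m y; first by lia.
      have [-> | /neq[mz' fmz']] := eqVneq m z; first by lia.
      have := free m; rewrite !ltnS.
      case/and5P=> h00 h01 h02 h10 /andP[h20 _].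
      by split; lia.
    + by have := free m; rewrite cT /= !ltnS; do 9 case/andP=> _; lia.
  - rewrite !ltnS; do 9 (apply/andP; split;
      first by (have := sw m; lia) || (have := ne m; lia)).
    by case: c box => //= /(_ isT m); lia.
have le3 : all (fun ab => (ab.1 <= 3) && (ab.2 <= 3)) (shaded_boxes c).
  by case: (c).
split.
  case/and3P => /= sorted_s /forallP iso; rewrite shadeE.
  move=> /(boxes_emptyP _ _ le3) free.
  have lt (i j : 'I_3) := eqP (forallP (iso i) j).
  apply/emptyE; [lia | | exact: free].
  have := lt (@Ordinal 3 0 isT) (@Ordinal 3 2 isT).
  have := lt (@Ordinal 3 2 isT) (@Ordinal 3 1 isT).
  by rewrite !perm132E /tnth /= => -> ->.
move=> H; have [xyz fxyz _ _ _] := H.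
apply/and3P; split => /=; first by lia.
  apply/forallP => i; apply/forallP => j; rewrite !perm132E !(tnth_nth x).
  by case: i j => [[|[|[|]]] //= ?] [[|[|[|]]] //= ?]; apply/eqP; lia.
by rewrite shadeE; apply/(boxes_emptyP _ _ le3)/emptyE.
Qed.

(** * Occurrences counted by middle positions *)

Definition middle (p : mesh_pattern 3) n (q : 'I_n) (pi : 'S_n) : bool :=
  [exists x, exists z, occurrence p pi [tuple x; q; z]].

(** By hypothesis the projection to the middle coordinate is injective on occurrences; its image is
    the set of middles. *)
Lemma card_middle (p : mesh_pattern 3) n (pi : 'S_n) :
  (forall x q z x' z', occurrence p pi [tuple x; q; z] ->
     occurrence p pi [tuple x'; q; z'] -> x = x' /\ z = z') ->
  occurrences p pi = #|[set q | middle p q pi]|.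
Proof.
move=> uniq_p; pose i1 := @Ordinal 3 1 isT.
have tupleE (s : 3.-tuple 'I_n) :
    s = [tuple tnth s ord0; tnth s i1; tnth s ord_max].
  apply: eq_from_tnth => -[[|[|[|//]]] lt_i3];
    rewrite [RHS](tnth_nth (tnth s ord0));
    by congr tnth; apply: val_inj.
rewrite /occurrences -(card_in_imset (f := fun s => tnth s i1)).
  apply: eq_card => q; rewrite [RHS]inE; apply/imsetP/existsP.
    case=> s; rewrite inE (tupleE s) => occ_s ->.
    by exists (tnth s ord0); apply/existsP; exists (tnth s ord_max).
  case=> x /existsP[z occ_s]; exists [tuple x; q; z] => //.
  by rewrite inE.
move=> s s'; rewrite !inE (tupleE s) (tupleE s').
move: (tnth s _) (tnth s _) (tnth s _) (tnth s' _) (tnth s' _) (tnth s' _).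
move=> x q z x' q' z' occ_s occ_s' /= qq'.
have {}qq' : q = q' by [].
by subst q'; have [-> ->] := uniq_p _ _ _ _ _ occ_s occ_s'.
Qed.

(** * The involution at a position *)

Section Toggle.

Variables (c : bool) (n : nat).
Implicit Types (p q r : 'I_n) (pi : 'S_n).

Let p123 := MeshPattern perm123 (shade c).
Let p132 := MeshPattern perm132 (shade c).

Lemma middle_rising q pi :
  middle p123 q pi <-> exists x z, rising c (fun i => pi i) x q z.
Proof.
split; first by case/existsP=> x /existsP[z /occurrence_rising]; exists x, z.
by case=> x [z /occurrence_rising ?]; apply/existsP; exists x;
  apply/existsP; exists z.
Qed.

Lemma middle_falling q pi :
  middle p132 q pi <-> exists x z, falling c (fun i => pi i) x q z.
Proof.
split; first by case/existsP=> x /existsP[z /occurrence_falling]; exists x, z.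
by case=> x [z /occurrence_falling ?]; apply/existsP; exists x;
  apply/existsP; exists z.
Qed.

Definition partner p pi r : bool :=
  [exists x, occurrence p123 pi [tuple x; p; r]
          || occurrence p132 pi [tuple x; p; r]].

Lemma partnerP p pi r :
  reflect (exists x, rising c (fun i => pi i) x p r \/
                     falling c (fun i => pi i) x p r) (partner p pi r).
Proof.
apply: (iffP existsP) => -[x H]; exists x.
  by case/orP: H => [/occurrence_rising|/occurrence_falling]; [left | right].
by apply/orP; case: H => [/occurrence_rising|/occurrence_falling];
  [left | right].
Qed.

(** The partner is unique, so [pick] makes no real choice. The left factor acts first:
    [tperm p r * pi] exchanges the values at positions [p] and [r]. *)
Definition toggle p pi : 'S_n :=
  if [pick r | partner p pi r] is Some r then (tperm p r * pi)%g else pi.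

Lemma pi_inj pi : injective (fun i => nat_of_ord (pi i)).
Proof. by move=> i j /val_inj/perm_inj. Qed.

Lemma partner_uniq p pi r r' : partner p pi r -> partner p pi r' -> r = r'.
Proof.
have injpi := @pi_inj pi.
case/partnerP=> x [] H /partnerP[x' [] H'].
- by have [] := rising_uniq H H'.
- by have := rising_not_falling H H'.
- by have := rising_not_falling H' H.
- by have [] := falling_uniq injpi H H'.
Qed.

Lemma exchanged_tperm p r pi :
  exchanged (fun i => pi i) (fun i => (tperm p r * pi)%g i) p r.
Proof.
split=> [||m mp mr]; rewrite permM ?tpermL ?tpermR //.
by rewrite tpermD // eq_sym.
Qed.

Lemma partner_tperm p r pi : partner p pi r -> partner p (tperm p r * pi)%g r.
Proof.
have H := exchanged_tperm p r pi.
case/partnerP=> x [] occ; apply/partnerP; exists x; [right | left].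
- exact: exchange_rising H occ.
- exact: exchange_falling H occ.
Qed.

Variant toggle_spec p pi : 'S_n -> Prop :=
| ToggleRising x r of rising c (fun i => pi i) x p r
    & falling c (fun i => (tperm p r * pi)%g i) x p r :
    toggle_spec p pi (tperm p r * pi)%g
| ToggleFalling x r of falling c (fun i => pi i) x p r
    & rising c (fun i => (tperm p r * pi)%g i) x p r :
    toggle_spec p pi (tperm p r * pi)%g
| ToggleNone of (forall x r, ~ rising c (fun i => pi i) x p r)
    & (forall x r, ~ falling c (fun i => pi i) x p r) :
    toggle_spec p pi pi.

Lemma toggleP p pi : toggle_spec p pi (toggle p pi).
Proof.
rewrite /toggle; case: pickP => [r /partnerP[x] | none].
  have H := exchanged_tperm p r pi.
  case=> occ.
    exact: ToggleRising occ (exchange_rising H occ).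
  exact: ToggleFalling occ (exchange_falling H occ).
by apply: ToggleNone => x r H; have /partnerP[] := none r; exists x;
  [left | right].
Qed.

(** [r] remains a partner after the exchange, so by uniqueness the second [pick] returns it and the
    transpositions cancel. *)
Lemma toggleK p : involutive (toggle p).
Proof.
move=> pi; rewrite {2}/toggle; case: pickP => [r pr | none].
  rewrite /toggle; case: pickP => [r' pr' | /(_ r)]; last first.
    by rewrite partner_tperm.
  rewrite (partner_uniq pr' (partner_tperm pr)) mulgA.
  by rewrite -{1}(tpermV p r) mulVg mul1g.
by rewrite /toggle; case: pickP => // r; rewrite none.
Qed.

Lemma middle_toggle p pi : middle p123 p (toggle p pi) = middle p132 p pi.
Proof.
apply/idP/idP => [/middle_rising | /middle_falling].
  case=> x [z]; case: toggleP => [x' r _ H1 H2 | x' r H1 _ _ | no _ /no //].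
    by case: (rising_not_falling H2 H1).
  by apply/middle_falling; exists x', r.
case=> x [z H]; apply/middle_rising.
case: toggleP => [x' r H1 _ | x' r _ H1 | _ /(_ _ _ H) //].
  by case: (rising_not_falling H1 H).
by exists x', r.
Qed.

(** The exchange lemma starts from a rising side, which is [pi] or its image; in the latter case
    [exchangedC] reverses the exchange. *)
Lemma middle_toggle_before p q pi :
  q < p -> middle p132 q (toggle p pi) = middle p132 q pi.
Proof.
move=> lt_qp; apply/idP/idP => /middle_falling H; apply/middle_falling; move: H;
  case: toggleP => // x r H1 H2; have E := exchanged_tperm p r pi;
  have injpi := @pi_inj pi; have injpi' := @pi_inj (tperm p r * pi)%g.
- by rewrite -(exchange_falling_before _ _ E H1).
- by rewrite (exchange_falling_before _ _ (exchangedC E) H2).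
- by rewrite (exchange_falling_before _ _ E H1).
- by rewrite -(exchange_falling_before _ _ (exchangedC E) H2).
Qed.

Lemma middle_toggle_after p q pi :
  p < q -> middle p123 q (toggle p pi) = middle p123 q pi.
Proof.
move=> lt_pq; apply/idP/idP => /middle_rising H; apply/middle_rising; move: H;
  case: toggleP => // x r H1 H2; have E := exchanged_tperm p r pi;
  have injpi := @pi_inj pi; have injpi' := @pi_inj (tperm p r * pi)%g.
- by rewrite -(exchange_rising_after _ E H1).
- by rewrite (exchange_rising_after _ (exchangedC E) H2).
- by rewrite (exchange_rising_after _ E H1).
- by rewrite -(exchange_rising_after _ (exchangedC E) H2).
Qed.

Lemma occurrences_rising pi :
  occurrences p123 pi = #|[set q | middle p123 q pi]|.
Proof.
apply: card_middle => x q z x' z' /occurrence_rising H /occurrence_rising.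
exact: rising_uniq H.
Qed.

Lemma occurrences_falling pi :
  occurrences p132 pi = #|[set q | middle p132 q pi]|.
Proof.
apply: card_middle => x q z x' z' /occurrence_falling H /occurrence_falling.
exact: falling_uniq (@pi_inj pi) H.
Qed.

End Toggle.

(** * Equidistribution for both shadings *)

Lemma shade_equidistributed c :
  MeshPattern perm123 (shade c) ~d MeshPattern perm132 (shade c).
Proof.
move=> n l.
under eq_finset do rewrite occurrences_rising.
under [in RHS]eq_finset do rewrite occurrences_falling.
apply: (hybrid_equidistribution (Phi := @toggle c n)).
- by move=> p; apply: inv_inj; apply: toggleK.
- exact: middle_toggle.
- exact: middle_toggle_before.
- exact: middle_toggle_after.
Qed.

Theorem theorem4p10 :
  (MeshPattern perm123 R1 ~d MeshPattern perm132 R1) /\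
  (MeshPattern perm123 R2 ~d MeshPattern perm132 R2).
Proof.
split; first exact: (shade_equidistributed false).
exact: (shade_equidistributed true).
Qed.
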